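(* Consider the case of a single mutable constraint in which all parameters $c$, $a$, $b$ are mutable. The algorithm described in the context (Algorithm A) calculates an optimal weak counterfactual explanation (whenever one exists).
   Context: Setting. $\mathcal X\subseteq\mathbb Z_+^n$ is the immutable feasible set (optimization problems over it are assumed solvable by a black-box solver), $\mathcal D\subseteq\mathbb Z_+^n$ is the favored solution space with $\mathcal D\cap\mathcal X\neq\emptyset$, and $\mathcal H\subseteq\mathbb Z^n\times\mathbb Z^{n}\times\mathbb Z$ is a bounded set containing the present parameters $(\hat c,\hat a,\hat b)$. The present problem is $\min\{\hat c^\top x:\hat a^\top x\ge\hat b,\ x\in\mathcal X\}$. A weak counterfactual explanation (weak CE) is $(c,a,b)\in\mathcal H$ with $\mathcal D\cap\operatorname{argmin}\{c^\top x: x\in\mathcal X,\ a^\top x\ge b\}\ne\emptyset$. Its cost is $\delta((c,a,b),(\hat c,\hat a,\hat b))\ge0$ for a given distance measure $\delta$; an optimal weak CE is one of minimal cost. $M$ denotes a sufficiently large constant, i.e. large enough that each of the inequalities below containing $M$ is redundant whenever its $M$-term is active (has coefficient $1$). Algorithm A. Set $\mathcal Y=\emptyset$. Repeat: compute an optimal solution $(\tilde a,\tilde b,\tilde c,\tilde x)$ of $$\begin{aligned}\min_{c,a,b,x,z}\ & \delta((c,a,b),(\hat c,\hat a,\hat b))\\ \text{s.t. }\ & c^\top x\le c^\top y+Mz_y,\quad a^\top y\ge b-Mz_y,\quad a^\top y\le b-1+M(1-z_y)\qquad\forall y\in\mathcal Y,\\ & x\in\mathcal D\cap\mathcal X,\quad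 a^\top x\ge b,\quad z_y\in\{0,1\}\ \forall y\in\mathcal Y,\quad (c,a,b)\in\mathcal H.\end{aligned}$$ Then compute an optimal solution $\tilde y$ of $\min\{\tilde c^\top y:\tilde a^\top y\ge\tilde b,\ y\in\mathcal X\}$. If $\tilde c^\top\tilde y<\tilde c^\top\tilde x$, add $\tilde y$ to $\mathcal Y$ and repeat; otherwise stop and return $(\tilde a,\tilde b,\tilde c)$. *)

(* Defs.v *)
From Stdlib Require Export Relation_Operators.
From HB Require Export structures.
From mathcomp Require Export all_boot all_order all_algebra.
From mathcomp Require Export boolp classical_sets reals.

Set Implicit Arguments.
Unset Strict Implicit.
Unset Printing Implicit Defensive.

Import Order.TTheory GRing.Theory Num.Theory.
Local Open Scope ring_scope.
Local Open Scope classical_set_scope.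

Definition dot (n : nat) (u v : 'cV[int]_n) : int := (u^T *m v) 0 0.

(* A triple (c, a, b): objective vector, constraint vector, right-hand side. *)
Definition params (n : nat) : Type := ('cV[int]_n * 'cV[int]_n * int)%type.

Definition pc (n : nat) (p : params n) : 'cV[int]_n := p.1.1.
Definition pa (n : nat) (p : params n) : 'cV[int]_n := p.1.2.
Definition pb (n : nat) (p : params n) : int := p.2.

Definition nonneg_vectors (n : nat) (S : set 'cV[int]_n) : Prop :=
  forall x, S x -> forall i, 0 <= x i 0.

Definition bounded_params (n : nat) (H : set (params n)) : Prop :=
  exists B : int, forall p, H p ->
    [/\ forall i, `|pc p i 0| <= B, forall i, `|pa p i 0| <= B & `|pb p| <= B].

Definition feasible (n : nat) (X : set 'cV[int]_n) (p : params n) :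
    set 'cV[int]_n :=
  [set x | X x /\ pb p <= dot (pa p) x].

Definition argmin (n : nat) (X : set 'cV[int]_n) (p : params n) :
    set 'cV[int]_n :=
  [set x | feasible X p x /\
    forall x', feasible X p x' -> dot (pc p) x <= dot (pc p) x'].

Definition solvable (n : nat) (X : set 'cV[int]_n) (H : set (params n)) : Prop :=
  forall p, H p -> feasible X p !=set0 -> argmin X p !=set0.

Definition weak_CE (n : nat) (X D : set 'cV[int]_n) (H : set (params n))
    (p : params n) : Prop :=
  H p /\ (D `&` argmin X p) !=set0.

Definition optimal_weak_CE (R : realType) (n : nat) (X D : set 'cV[int]_n)
    (H : set (params n)) (delta : params n -> params n -> R) (phat : params n)
    (p : params n) : Prop :=
  weak_CE X D H p /\
  forall q, weak_CE X D H q -> delta p phat <= delta q phat.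

Section Algorithm.
Variables (R : realType) (n : nat).
Variables (X D : set 'cV[int]_n) (H : set (params n)).
Variables (delta : params n -> params n -> R) (phat : params n) (M : R).

(* The binary variables z_y are given by z : 'cV[int]_n -> bool, whose values
   outside Y are irrelevant. *)
Definition master_feasible (Y : set 'cV[int]_n)
    (p : params n) (x : 'cV[int]_n) (z : 'cV[int]_n -> bool) : Prop :=
  [/\ forall y, Y y ->
        [/\ (dot (pc p) x)%:~R <= (dot (pc p) y)%:~R + M * (z y)%:R,
            (dot (pa p) y)%:~R >= (pb p)%:~R - M * (z y)%:R &
            (dot (pa p) y)%:~R <= (pb p)%:~R - 1 + M * (1 - (z y)%:R)],
      (D `&` X) x,
      dot (pa p) x >= pb p &
      H p].

Definition master_optimal (Y : set 'cV[int]_n)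
    (p : params n) (x : 'cV[int]_n) (z : 'cV[int]_n -> bool) : Prop :=
  master_feasible Y p x z /\
  forall p' x' z', master_feasible Y p' x' z' -> delta p phat <= delta p' phat.

Inductive state : Type :=
| Running of set 'cV[int]_n
| Returned of params n.

(* One iteration; the two solver calls may return any optimal solution. *)
Inductive step : state -> state -> Prop :=
| step_add Y p x z y :
    master_optimal Y p x z -> argmin X p y ->
    dot (pc p) y < dot (pc p) x ->
    step (Running Y) (Running (Y `|` [set y]))
| step_stop Y p x z y :
    master_optimal Y p x z -> argmin X p y ->
    ~ dot (pc p) y < dot (pc p) x ->
    step (Running Y) (Returned p).

Definition reachable (s : state) : Prop :=
  clos_refl_trans state step (Running set0) s.

(* Redundant means implied by the constraints that do not involve M; required
   only for the master problems that the algorithm can actually meet. *)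
Definition sufficiently_large : Prop :=
  forall Y, reachable (Running Y) -> forall y, Y y ->
  forall p x, H p -> (D `&` X) x -> dot (pa p) x >= pb p ->
    [/\ (dot (pc p) x)%:~R <= (dot (pc p) y)%:~R + M,
        (dot (pa p) y)%:~R >= (pb p)%:~R - M &
        (dot (pa p) y)%:~R <= (pb p)%:~R - 1 + M].

(* Total correctness: no run gets stuck, no run is infinite, and every returned
   value satisfies post. *)
Definition algorithm_calculates (post : params n -> Prop) : Prop :=
  [/\ forall Y, reachable (Running Y) -> exists s, step (Running Y) s,
      ~ (exists run : nat -> state,
           run 0%N = Running set0 /\ forall k, step (run k) (run k.+1)) &
      forall p, reachable (Returned p) -> post p].

End Algorithm.

(* Main.v *)
(* Every weak CE, with z_y marking whether y is infeasible for it, stays feasible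
   for each master problem, so a returned master optimum that is itself a weak CE
   is an optimal one.  A parameter triple p chosen in a continuing iteration never
   recurs: its argmin y then lies in Y, where a^T y >= b forces z_y = 0 and hence
   c^T x <= c^T y, so p would make the algorithm stop.  As H is finite, being a
   bounded set of integer vectors, the algorithm terminates. *)
Require Import Defs.
From mathcomp Require Import zify.

Set Implicit Arguments.
Unset Strict Implicit.
Unset Printing Implicit Defensive.

Import Order.TTheory GRing.Theory Num.Theory.
Local Open Scope ring_scope.
Local Open Scope classical_set_scope.

Lemma int_shift_ord (N : nat) (v : int) : `|v| <= N%:Z ->
  exists i : 'I_N.*2.+1, v = i%:Z - N%:Z.
Proof.
move=> hv; have hlt : (absz (v + N%:Z)%R < N.*2.+1)%N by lia.
by exists (Ordinal hlt) => /=; lia.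
Qed.

(** Shifting by [N] turns each integer entry into an ordinal below 2N+1, so [H] lies in the image of
    a finite type under [dec]. *)
Lemma bounded_params_enum (n : nat) (H : set (params n)) :
  bounded_params H -> exists s : seq (params n), forall p, H p -> p \in s.
Proof.
move=> [B hB]; set N := absz B.
have hBN (v : int) : `|v| <= B -> `|v| <= N%:Z by rewrite /N; lia.
pose vec (f : {ffun 'I_n -> 'I_N.*2.+1}) : 'cV[int]_n :=
  \col_i ((f i)%:Z - N%:Z).
have vecP (v : 'cV[int]_n) : (forall i, `|v i 0| <= B) -> exists f, v = vec f.
  move=> hv; have /choice[f hf] i := int_shift_ord (hBN _ (hv i)).
  by exists (finfun f); apply/matrixP => i j; rewrite ord1 mxE ffunE -hf.
pose dec (t : {ffun 'I_n -> 'I_N.*2.+1} * {ffun 'I_n -> 'I_N.*2.+1} *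
    'I_N.*2.+1) : params n := (vec t.1.1, vec t.1.2, t.2%:Z - N%:Z).
exists (codom dec) => -[[c a] b] /hB[hc ha hb].
have [[f ->] [g ->]] := (vecP c hc, vecP a ha).
by have [i ->] := int_shift_ord (hBN b hb); exact: (codom_f dec (f, g, i)).
Qed.

(** Finiteness makes the minimum attained; this will give a master optimum, [delta] being an
    arbitrary function. *)
Lemma seq_argmin (T : eqType) (R : realDomainType) (f : T -> R) (s : seq T)
    (P : T -> Prop) :
  (forall p, P p -> p \in s) -> (exists p, P p) ->
  exists2 p, P p & forall q, P q -> f p <= f q.
Proof.
move=> hs [p0 hp0].
pose i0 : 'I_(size s) := Ordinal (etrans (index_mem p0 s) (hs _ hp0)).
pose Q : pred 'I_(size s) := fun i => `[< P (nth p0 s i) >].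
have hi0 : Q i0 by apply/asboolP; rewrite nth_index ?hs.
case: (@arg_minP _ _ _ i0 Q (fun i => f (nth p0 s i)) hi0) => i /asboolP hi hmin.
exists (nth p0 s i) => // q hq.
have := hmin (Ordinal (etrans (index_mem q s) (hs _ hq))).
by rewrite /Q /= nth_index ?hs //; apply; exact/asboolP.
Qed.

Lemma no_injective_sequence_in_seq (T : eqType) (s : seq T) (u : nat -> T) :
  (forall k, u k \in s) -> ~ injective u.
Proof.
move=> hu inj.
have := @uniq_leq_size _ (mkseq u (size s).+1) s.
rewrite mkseq_uniq // size_mkseq ltnn => /(_ isT) hlt.
by suff: false by []; apply: hlt => _ /mapP[k _ ->].
Qed.

Section Correctness.
Variables (R : realType) (n : nat).
Variables (X D : set 'cV[int]_n) (H : set (params n)).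
Variables (delta : params n -> params n -> R) (phat : params n) (M : R).

Notation state := (state n).
Notation step := (step X D H delta phat M).
Notation reachable := (reachable X D H delta phat M).
Notation sufficiently_large := (sufficiently_large X D H delta phat M).
Notation master_feasible := (master_feasible X D H M).
Notation master_optimal := (master_optimal X D H delta phat M).

Definition found (s : state) : set 'cV[int]_n :=
  if s is Running Y then Y else set0.

Lemma reachable_found_sub (s : state) : reachable s -> found s `<=` X.
Proof.
(* Transitivity is a constructor of the closure, so the induction needs an arbitrary start state. *)
suff hinv (s0 : state) : clos_refl_trans state step s0 s ->
    found s0 `<=` X -> found s `<=` X by move=> /hinv; apply; exact: sub0set.
elim=> {s0 s} [s s'|//|s1 s2 s3 _ h12 _ h23 /h12/h23//].
case=> [Y p x z y _ [[hy _] _] _ hY w [/hY //|-> //]|*].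
exact: sub0set.
Qed.

Lemma weak_CE_master_feasible (Y : set 'cV[int]_n) (p : params n) :
  sufficiently_large -> reachable (Running Y) -> weak_CE X D H p ->
  exists x z, master_feasible Y p x z.
Proof.
move=> hM hY [hp [x [hDx [[hXx hx] hmin]]]].
exists x, (fun y => dot (pa p) y < pb p); split=> // y hy.
have [h1 h2 h3] := hM _ hY y hy p x hp (conj hDx hXx) hx.
(* If [y] is infeasible for [p], integrality sharpens a^T y < b to a^T y <= b - 1; if it is
   feasible, optimality of [x] gives c^T x <= c^T y. The inequalities with an active [M] are [h1],
   [h2], [h3]. *)
case: ltP => hlt; split; rewrite ?mulr1 ?mulr0 ?subr0 ?addr0 ?subrr //.
- by rewrite mulr0 addr0 -[X in _ - X]/(1%:~R) -intrB ler_int; lia.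
- by rewrite ler_int; apply: hmin; split=> //; exact: (reachable_found_sub hY).
- by rewrite ler_int.
- by rewrite mulr1.
Qed.

Lemma exists_step (Y : set 'cV[int]_n) :
  solvable X H -> bounded_params H -> sufficiently_large ->
  (exists p, weak_CE X D H p) -> reachable (Running Y) ->
  exists s, step (Running Y) s.
Proof.
move=> hsolv /bounded_params_enum[s hs] hM [q hq] hY.
(* The objective depends on [p] alone, so it suffices to minimize over the finitely many triples
   that admit some [x] and [z]; [D] and [X] may be infinite. *)
have [p [x [z hp]] hmin] : exists2 p, exists x z, master_feasible Y p x z &
    forall p', (exists x z, master_feasible Y p' x z) ->
      delta p phat <= delta p' phat.
  apply: (@seq_argmin _ _ _ s); last first.
    by exists q; exact: weak_CE_master_feasible.
  by move=> p [x [z [_ _ _ /hs]]].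
have hopt : master_optimal Y p x z.
  by split=> // p' x' z' h; apply: hmin; exists x', z'.
have [_ [_ hXx] hx hHp] := hp.
have [y hy] : argmin X p !=set0 by apply: hsolv => //; exists x.
case: (boolP (dot (pc p) y < dot (pc p) x)) => [hlt|/negP hlt].
  by exists (Running (Y `|` [set y])); exact: step_add hopt hy hlt.
by exists (Returned p); exact: step_stop hopt hy hlt.
Qed.

Lemma returned_optimal (p : params n) :
  sufficiently_large -> reachable (Returned p) ->
  optimal_weak_CE X D H delta phat p.
Proof.
(* This form of the closure exposes the last step, which must be a stopping one. *)
move=> hM /(@Operators_Properties.clos_rt_rtn1 state) hp.
inversion hp as [|s s' hstep hreach]; subst.
inversion hstep as [|Y p' x z y [[_ [hDx hXx] hx hHp] hmin] [_ hy] hge]; subst.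
split.
  split=> //; exists x; split=> //; split=> // x' /hy; apply: le_trans.
  by rewrite leNgt; apply/negP.
have hY : reachable (Running Y) by exact: Operators_Properties.clos_rtn1_rt.
by move=> q /(weak_CE_master_feasible hM hY)[x' [z' /hmin]].
Qed.

(** The solver may return a minimizer [y'] other than the [y] stored in [Y]; as c^T y <= c^T y', the
    bound from [y] carries over. *)
Lemma master_feasible_argmin_le (Y : set 'cV[int]_n) p x z (y y' : 'cV[int]_n) :
  master_feasible Y p x z -> Y y -> argmin X p y -> argmin X p y' ->
  dot (pc p) x <= dot (pc p) y'.
Proof.
move=> [hY _ _ _] /hY[h1 _ h3] [hy hmin] [hy' _].
apply: le_trans (hmin _ hy'); case: hy h1 h3 => _ hy.
case: (z y) => /=; last by rewrite mulr0 addr0 ler_int.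
rewrite subrr mulr0 addr0 -[X in _ - X]/(1%:~R) -intrB ler_int; lia.
Qed.

(* The second step only serves to guarantee that s' is not a returned value. *)
Lemma step_new_params (s s' s'' : state) : step s s' -> step s' s'' ->
  found s `<=` found s' /\
  exists p, [/\ H p, ~ (found s `&` argmin X p !=set0) &
                found s' `&` argmin X p !=set0].
Proof.
case=> [Y p x z y [hfeas _] hy hlt _|Y p x z y _ _ _ hstop]; last by inversion hstop.
split; first exact: subsetUl.
exists p; split; first by case: hfeas.
  move=> [y' [hy'Y hy']].
  by have := master_feasible_argmin_le hfeas hy'Y hy' hy; rewrite leNgt hlt.
by exists y; split=> //; right.
Qed.

Lemma no_infinite_run : bounded_params H ->
  ~ exists run : nat -> state, forall k, step (run k) (run k.+1).
Proof.
move=> /bounded_params_enum[s hs] [run hrun].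
have hnew k := step_new_params (hrun k) (hrun k.+1).
have /choice[u hu] k := (hnew k).2.
have hmono j k : (j <= k)%N -> found (run j) `<=` found (run k).
  elim: k => [|k IH]; first by rewrite leqn0 => /eqP->.
  rewrite leq_eqVlt => /predU1P[->//|/IH hjk].
  exact: subset_trans hjk (hnew k).1.
(* From stage j+1 on, the found set contains a minimizer for [u j], whereas at stage k it contains
   none for [u k]. *)
have hneq j k : (j < k)%N -> u j <> u k.
  move=> /hmono hjk ujk; have [_ _ [y [hy hyj]]] := hu j.
  by have [_ + _] := hu k; apply; exists y; split; [exact: hjk|rewrite -ujk].
apply: (@no_injective_sequence_in_seq _ s u) => [k|j k ujk].
  by apply: hs; case: (hu k).
by case: (ltngtP j k) => // /hneq; rewrite ujk.
Qed.

End Correctness.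

Theorem theorem8 (R : realType) (n : nat)
    (X D : set 'cV[int]_n) (H : set (params n))
    (delta : params n -> params n -> R) (phat : params n) (M : R)
    (hX : nonneg_vectors X)
    (hsolv : solvable X H)
    (hD : nonneg_vectors D)
    (hDX : (D `&` X) !=set0)
    (hH : bounded_params H)
    (hphat : H phat)
    (hdelta : forall p, 0 <= delta p phat)
    (hM : sufficiently_large X D H delta phat M)
    (hCE : exists p, weak_CE X D H p) :
  algorithm_calculates X D H delta phat M
    (optimal_weak_CE X D H delta phat).
Proof.
split=> [Y|[run [_ hrun]]|p].
- exact: exists_step.
- by apply: (no_infinite_run hH); exists run.
- exact: returned_optimal.
Qed.
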